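(* Let $\mathbb{P}(\omega)$ be a well formed $n$-dimensional weighted projective space and let $\mathcal{C}=V(a_1,\dots,a_{n-1})\subset\mathbb{P}(\omega)$ be a smooth weighted complete intersection curve. Suppose $\mathcal{F}$ is a one-dimensional holomorphic foliation of degree $d$ on $\mathbb{P}(\omega)$ which leaves $\mathcal{C}$ invariant. Then $$a_1+\cdots+a_{n-1}\leq d+\omega_0+\cdots+\omega_n.$$
   Context: Weighted projective space. For positive integers $\omega=(\omega_0,\dots,\omega_n)$ with $\gcd$ equal to $1$, $\mathbb{P}(\omega)=(\mathbb{C}^{n+1}-\{0\})/\mathbb{C}^*$ with action $t\cdot(z_0,\dots,z_n)=(t^{\omega_0}z_0,\dots,t^{\omega_n}z_n)$, so $\deg z_i=\omega_i$. ''Well formed'' here means that the $\omega_i$ are pairwise coprime. Complete intersection. $\mathcal{C}=V(a_1,\dots,a_{n-1})$ is a smooth one-dimensional weighted complete intersection: the scheme-theoretic zero locus in $\mathbb{P}(\omega)$ of $n-1$ weighted homogeneous polynomials $f_1,\dots,f_{n-1}$ of degrees $a_1,\dots,a_{n-1}$. Foliations. A one-dimensional holomorphic foliation $\mathcal{F}$ of degree $d$ on $\mathbb{P}(\omega)$ is a global section of $\mathcal{T}\mathbb{P}(\omega)\otimes\mathcal{O}_{\mathbb{P}(\omega)}(d)$, where $\mathcal{T}\mathbb{P}(\omega)$ is the Zariski tangent sheaf, whose singular scheme has codimension greater than $1$. In homogeneous coordinates it is given by a vector field $X=\sum_{i=0}^nP_i\frac{\partial}{\partial z_i}$ with $P_i$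 weighted homogeneous of degree $d+\omega_i$, modulo multiples of the radial vector field $R=\sum_i\omega_iz_i\frac{\partial}{\partial z_i}$. $\mathcal{F}$ leaves $\mathcal{C}$ invariant if $X$ is tangent to $\mathcal{C}$, i.e. $X(f_i)$ belongs to the ideal $(f_1,\dots,f_{n-1})$ for every $i$ (for a hypersurface $\{f=0\}$ this is the condition $X(f)=g\cdot f$).
   Formalization: The curve C is additionally assumed not to be contained in the singular set of the foliation F, and ''smooth'' is taken to mean that the affine cone over C is smooth away from the origin; without either condition the inequality can fail. *)

(* Defs.v *)
From HB Require Import structures.
From mathcomp Require Import all_boot all_order all_algebra.
From mathcomp Require Import classical_sets reals.
From mathcomp Require Export complex.
From mathcomp Require Export mpoly.

Set Implicit Arguments.
Unset Strict Implicit.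
Unset Printing Implicit Defensive.

Import GRing.Theory Num.Theory.
Local Open Scope ring_scope.
Local Open Scope classical_set_scope.

(* The complex numbers are R[i] for R : realType.  P(w) is described by its
   homogeneous coordinates z_0, ..., z_n: a subset of P(w) is represented by
   its preimage in C^{n+1} - {0}. *)

Section WeightedProjectiveSpace.
Variables (R : realType) (n : nat) (w : 'I_n.+1 -> nat).
Local Notation C := (R[i]).
Local Notation S := {mpoly C[n.+1]}.
Local Notation point := ('I_n.+1 -> C).

Definition well_formed : Prop :=
  (forall i, (0 < w i)%N) /\ (forall i j, i != j -> coprime (w i) (w j)).

(* The degree k is an integer since foliations may have negative degree; only
   0 is homogeneous of negative degree. *)
Definition whomog (k : int) (p : S) : Prop :=
  forall m : 'X_{1..n.+1}, m \in msupp p -> (\sum_(i < n.+1) w i * m i)%N%:Z = k.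

Definition wproj : set point := [set z | exists i, z i != 0].

Definition zero_locus (F : set S) : set point :=
  [set z | wproj z /\ forall p, F p -> p.@[z] = 0].

Definition zclosed (Z : set point) : Prop :=
  exists F : set S,
    (forall p, F p -> exists k : nat, whomog k%:Z p) /\ Z = zero_locus F.

Definition zirreducible (Z : set point) : Prop :=
  [/\ zclosed Z, Z !=set0 &
   forall Y1 Y2, zclosed Y1 -> zclosed Y2 ->
     Z `<=` Y1 `|` Y2 -> Z `<=` Y1 \/ Z `<=` Y2].

(* The codimension of Z is the infimum, over the irreducible closed Y contained
   in Z, of the supremum of the lengths of the chains of irreducible closed
   subsets of P(w) starting at Y. *)
Definition codim_gt1 (Z : set point) : Prop :=
  forall Y, zirreducible Y -> Y `<=` Z ->
    exists Y1 Y2, [/\ zirreducible Y1, zirreducible Y2, Y `<` Y1 & Y1 `<` Y2].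

(* P : 'I_n.+1 -> S stands for the vector field X = \sum_i P_i d/dz_i. *)
Definition vfield_apply (P : 'I_n.+1 -> S) (p : S) : S :=
  \sum_(i < n.+1) P i * p^`M(i).

(* The zeros of the section of TP(w)(d) induced by X, i.e. of the class of X
   modulo R = \sum_i w_i z_i d/dz_i, are the points where X and R are linearly
   dependent. *)
Definition sing (P : 'I_n.+1 -> S) : set point :=
  [set z | wproj z /\
    forall i j, (w j)%:R * z j * (P i).@[z] = (w i)%:R * z i * (P j).@[z]].

Definition foliation (d : int) (P : 'I_n.+1 -> S) : Prop :=
  (forall i, whomog (d + (w i)%:Z) (P i)) /\ codim_gt1 (sing P).

Section Curve.
Variable f : 'I_n.-1 -> S.

Definition curve : set point := zero_locus (range f).

Definition in_ideal (p : S) : Prop :=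
  exists h : 'I_n.-1 -> S, p = \sum_(j < n.-1) h j * f j.

Definition jacobian (z : point) : 'M[C]_(n.-1, n.+1) :=
  \matrix_(j, i) (f j)^`M(i).@[z].

(* Smoothness of subvarieties of P(w) is understood in the usual (orbifold)
   sense: the affine cone over the curve is smooth outside the origin, which
   is the Jacobian criterion in homogeneous coordinates. *)
Definition smooth_complete_intersection_curve (a : 'I_n.-1 -> nat) : Prop :=
  [/\ forall j, (0 < a j)%N,
      forall j, whomog (a j)%:Z (f j) &
      forall z, curve z -> \rank (jacobian z) = n.-1].

Definition tangent_to_curve (P : 'I_n.+1 -> S) : Prop :=
  forall j, in_ideal (vfield_apply P (f j)).

End Curve.
End WeightedProjectiveSpace.

(* Main.v *)
Require Import Defs.
From mathcomp Require Import all_boot all_order all_algebra.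
From mathcomp Require Import classical_sets reals.
From mathcomp Require Import boolp cardinality.
From mathcomp Require finmap.
From mathcomp Require Import perm ring zify.
Local Open Scope ring_scope.

(** Let [X] be the vector field [P] and [R] the radial one.  Both are tangent to the cone
    over the curve, which is a surface with equations [f]; so the coefficients of the bivector
    [X /\ R] are proportional on the cone to the complementary maximal minors of the Jacobian
    matrix of [f] ([wedge_minor_mod_ideal]).  The factor of proportionality
    [g = wedge i k / bordered_jacobian i k] is homogeneous of degree
    [excess = d + \sum_i w i - \sum_j a j], it is regular away from the origin because the
    curve is smooth, and it is not zero because the curve is not contained in the singular
    locus.  The theorem says that the degree of such a [g] is not negative, as it is for any
    nonzero section of a line bundle on a projective curve.

    Regularity is used in the following algebraic form: by the Nullstellensatz the minors and
    [f] generate an ideal that contains a power of every variable, so [g] times any form of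
    large degree is again a polynomial on the cone ([conductor_large], [multiplication]).  The
    Nullstellensatz itself is proved by a counting argument that exploits that the field of
    complex numbers is uncountable ([prime_ideal_variable]).

    The cone is not known to be irreducible, so one has to restrict [g] to the component
    through a point [p] at which [X] and [R] are independent.  In place of this component one
    can take the formal integral curve of [X] through [p]: by tangency the polynomials that
    vanish on it form an ideal that contains [f], and this ideal is prime
    ([flow_ideal_prime]).  Multiplication by [g] therefore preserves linear independence on
    the integral curve ([flow_free_step]).  If [excess] were negative, the dimension of the
    space of forms of degree [e], restricted to the integral curve, would be bounded
    independently of [e]: repeated multiplication by [g] lowers the degree into a fixed finite
    range.  But the integral curve is transverse to [R] at [p], so a ratio of powers of two of
    the coordinates is not constant along it, and these two powers generate arbitrarily many
    independent forms of the same degree ([flow_free_monomials]). *)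

Set Implicit Arguments.
Unset Strict Implicit.
Unset Printing Implicit Defensive.
Import Order.TTheory GRing.Theory Num.Theory.

(** * Ideals *)

Section Ideals.
Variable A : comNzRingType.
Implicit Types (I Q : A -> Prop) (x y c g h : A).

Definition is_ideal I : Prop :=
  [/\ I 0, forall x y, I x -> I y -> I (x + y) & forall c x, I x -> I (c * x)].

Definition prime_ideal I : Prop :=
  [/\ is_ideal I, ~ I 1 & forall x y, I (x * y) -> I x \/ I y].

Lemma ideal0 I : is_ideal I -> I 0. Proof. by case. Qed.
Lemma idealD I x y : is_ideal I -> I x -> I y -> I (x + y).
Proof. by case=> _ + _; apply. Qed.
Lemma ideal_mull I c x : is_ideal I -> I x -> I (c * x).
Proof. by case=> _ _; apply. Qed.
Lemma ideal_mulr I c x : is_ideal I -> I x -> I (x * c).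
Proof. by move=> II Ix; rewrite mulrC; apply: ideal_mull. Qed.
Lemma idealN I x : is_ideal I -> I x -> I (- x).
Proof. by rewrite -mulN1r; apply: ideal_mull. Qed.
Lemma idealB I x y : is_ideal I -> I x -> I y -> I (x - y).
Proof. by move=> II Ix Iy; apply: idealD => //; apply: idealN. Qed.
Lemma ideal_sum I (T : Type) (r : seq T) (K : pred T) (F : T -> A) :
  is_ideal I -> (forall i, K i -> I (F i)) -> I (\sum_(i <- r | K i) F i).
Proof. by case=> I0 ID _ IF; apply: big_ind. Qed.

Lemma ideal_subl I x y : is_ideal I -> I (x - y) -> I x -> I y.
Proof. by move=> II Ixy Ix; rewrite -(subKr x y); apply: idealB. Qed.
Lemma ideal_subr I x y : is_ideal I -> I (x - y) -> I y -> I x.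
Proof. by move=> II Ixy Iy; rewrite -(subrK y x); apply: idealD. Qed.

Lemma primeX I x N : prime_ideal I -> I (x ^+ N) -> I x.
Proof.
move=> [II I1 IM]; elim: N => [|N IHN]; first by rewrite expr0.
by rewrite exprS => /IM[].
Qed.

(** The determinant is polynomial in the entries, hence well defined modulo an ideal. *)
Lemma ideal_det I (m : nat) (B C : 'M[A]_m) : is_ideal I ->
  (forall i j, I (B i j - C i j)) -> I (\det B - \det C).
Proof.
move=> II BC; rewrite /determinant.
apply: (big_ind2 (fun x y => I (x - y))) => [|x1 x2 y1 y2 h1 h2|s _].
- by rewrite subrr; exact: ideal0.
- by rewrite opprD addrACA; exact: idealD.
rewrite -mulrBr; apply: ideal_mull => //.
apply: (big_ind2 (fun x y => I (x - y))) => [|x1 x2 y1 y2 h1 h2|i _] //.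
- by rewrite subrr; exact: ideal0.
- rewrite (_ : _ - _ = y1 * (x1 - x2) + x2 * (y1 - y2)); last by ring.
  by apply: idealD => //; exact: ideal_mull.
Qed.

(** Zorn's lemma gives an ideal [Q] maximal among those that contain [J] and avoid the
    powers of [g].  Adjoining any further [h] to it produces a power of [g]: this is the
    last clause, and the reason why [Q] is prime. *)
Lemma prime_avoiding_powers (J : A -> Prop) g : is_ideal J -> (forall N, ~ J (g ^+ N)) ->
  exists Q, [/\ prime_ideal Q, forall h, J h -> Q h, ~ Q g &
    forall h, ~ Q h -> exists N q, Q (q * h - g ^+ N)].
Proof.
move=> IJ Jg.
(* Zorn is applied to the sets [B] with [B `|` J] an ideal, so that the empty chain
   is bounded too. *)
pose add_J (B : set A) : A -> Prop := fun x => B x \/ J x.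
pose P (B : set A) := is_ideal (add_J B) /\ forall N, ~ add_J B (g ^+ N).
have [] := @Zorn_bigcup A P.
  move=> F FP Ftot; split; last first.
    by move=> N [[B FB Bg]|/Jg//]; case: (FP B FB) => _ /(_ N); apply; left.
  split.
  - by right; exact: ideal0.
  - move=> x y [[B FB Bx]|Jx] [[C FC Cy]|Jy]; last by right; exact: idealD.
    + have [BC|CB] := Ftot B C FB FC.
      * have [IC _] := FP C FC.
        by have [|] := idealD IC (or_introl (BC _ Bx)) (or_introl Cy);
          [left; exists C | right].
      * have [IB _] := FP B FB.
        by have [|] := idealD IB (or_introl Bx) (or_introl (CB _ Cy));
          [left; exists B | right].
    + have [IB _] := FP B FB.
      by have [|] := idealD IB (or_introl Bx) (or_intror Jy);
        [left; exists B | right].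
    + have [IC _] := FP C FC.
      by have [|] := idealD IC (or_intror Jx) (or_introl Cy);
        [left; exists C | right].
  - move=> c x [[B FB Bx]|Jx]; last by right; exact: ideal_mull.
    have [IB _] := FP B FB.
    by have [|] := ideal_mull c IB (or_introl Bx); [left; exists B | right].
move=> B [[IQ Qg] maxB]; pose Q := add_J B.
have Q_max h : ~ Q h -> exists N q, Q (q * h - g ^+ N).
  move=> Qh; pose Qh' : set A := fun x => exists y q, Q y /\ x = y + q * h.
  have sub x : Q x -> Qh' x by move=> Qx; exists x, 0; rewrite mul0r addr0.
  have IQ' : is_ideal (add_J Qh').
    have sub' x : add_J Qh' x -> Qh' x by case=> // Jx; apply: sub; right.
    split; first by left; apply: sub; exact: (ideal0 IQ).
    - move=> x y /sub'[u [q [Qu ->]]] /sub'[v [r [Qv ->]]]; left.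
      exists (u + v), (q + r); split; first exact: (idealD IQ).
      by ring.
    - move=> c x /sub'[u [q [Qu ->]]]; left; exists (c * u), (c * q).
      by split; [exact: (ideal_mull _ IQ) | ring].
  have [//|noQ'] := pselect (exists N, Qh' (g ^+ N)).
    move=> [N [y [q [Qy gN]]]]; exists N, q; rewrite gN.
    by rewrite opprD addrCA subrr addr0; exact: (idealN IQ).
  exfalso; apply: (maxB Qh').
    split; first by move=> x Bx; apply: sub; left.
    move=> Q'B; apply: Qh; left; apply: Q'B.
    by exists 0, 1; rewrite mul1r add0r; split => //; exact: (ideal0 IQ).
  split => // N [Q'g|/Jg//]; by apply: noQ'; exists N.
exists Q; split => //; first split => //.
- by move=> Q1; apply: (Qg 0%N); rewrite expr0.
- move=> x y Qxy; apply: contrapT => /not_orP[].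
  move=> /Q_max[N [q Hx]] /Q_max[M [r Hy]]; apply: (Qg (N + M)%N).
  have := ideal_mull (q * r) IQ Qxy; apply: (ideal_subl IQ).
  rewrite exprD (_ : _ - _ = r * y * (q * x - g ^+ N)
                            + g ^+ N * (r * y - g ^+ M)); last by ring.
  by apply: (idealD IQ); exact: (ideal_mull _ IQ).
- by move=> h Jh; right.
- by move=> Qg1; apply: (Qg 1%N); rewrite expr1.
Qed.

End Ideals.

(** * The Nullstellensatz over an uncountable field *)

(** The form in which the uncountability of a field enters: the polynomials attached to its
    elements have countably many possible degrees, so infinitely many of them share one. *)
Definition infinite_fibres (F : eqType) : Prop := forall kappa : F -> nat,
  exists k, forall N, exists2 s : seq F,
    uniq s & size s = N /\ {in s, forall c, kappa c = k}.

Section Nullstellensatz.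
Variables (F : closedFieldType) (n : nat).
Local Notation S := {mpoly F[n]}.

Lemma linear_relation_of_msize (K m : nat) (u : 'I_m -> S) :
  (#|{: 'X_{1..n < K}}| < m)%N -> (forall r, msize (u r) <= K)%N ->
  exists2 l : 'I_m -> F, (exists r, l r != 0) & \sum_r l r *: u r = 0.
Proof.
move=> ltm su; set D := #|_| in ltm.
pose B : 'M_(m, D) := \matrix_(r, j) (u r)@_(enum_val j : 'X_{1..n < K}).
have : kermx B != 0.
  by rewrite kermx_eq0 /row_free neq_ltn (leq_ltn_trans (rank_leq_col B)).
move=> /rowV0Pn[v /sub_kermxP vB v0]; exists (v 0).
  apply/existsP; apply: contraNT v0 => /existsPn vr0; apply/eqP/rowP => r.
  by rewrite mxE; apply/eqP; rewrite -[_ == _]negbK vr0.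
under eq_bigr => r _ do rewrite (mpolywE (su r)) scaler_sumr.
rewrite exchange_big big1 //= => b _.
under eq_bigr => r _ do rewrite scalerA.
rewrite -scaler_suml (_ : \sum_r _ = (v *m B) 0 (enum_rank b)).
  by rewrite vB mxE scale0r.
by rewrite mxE; apply: eq_bigr => r _; rewrite mxE enum_rankK.
Qed.

Lemma eval_mod_ideal (Q : S -> Prop) (c : 'I_n -> F) : is_ideal Q ->
  (forall l, Q ('X_l - (c l)%:MP)) -> forall h, Q (h - h.@[c]%:MP).
Proof.
move=> IQ Qc h.
have QM x y x' y' : Q (x - x') -> Q (y - y') -> Q (x * y - x' * y').
  move=> Qx Qy; rewrite (_ : _ - _ = y * (x - x') + x' * (y - y')); last by ring.
  by apply: (idealD IQ); exact: (ideal_mull _ IQ).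
have Q1 : Q (1 - 1) by rewrite subrr; exact: (ideal0 IQ).
rewrite [h in h - _](mpolyE h) mevalE raddf_sum /= -sumrB.
apply: (ideal_sum _ IQ) => m _.
rewrite -mul_mpolyC mpolyCM -mulrBr; apply: (ideal_mull _ IQ).
rewrite mpolyXE_id rmorph_prod /=.
apply: (big_ind2 (fun x y => Q (x - y))) => // [x x' y y'|i _]; first exact: QM.
rewrite rmorphXn /=; elim: (m i) => [|k IHk]; first by rewrite !expr0.
by rewrite !exprS; exact: QM.
Qed.

Lemma prime_ideal_linear_factor (Q : S -> Prop) (l : 'I_n) (p : {poly F}) :
  prime_ideal Q -> p != 0 -> Q (horner_alg ('X_l : S) p) ->
  exists c, Q ('X_l - c%:MP).
Proof.
move=> [IQ Q1 QM] p0 Qp.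
have [rs Ep] := closed_field_poly_normal p.
move: Qp; rewrite Ep linearZ /= alg_mpolyC => /QM[Qc|].
  case: Q1; rewrite (_ : 1 = (lead_coef p)^-1%:MP * (lead_coef p)%:MP :> S).
    exact: (ideal_mull _ IQ Qc).
  by rewrite -mpolyCM mulVf // lead_coef_eq0.
elim: rs {Ep} => [|c rs IHrs]; first by rewrite big_nil rmorph1 => /Q1.
rewrite big_cons rmorphM => /QM[|//].
by rewrite rmorphB /= horner_algX horner_algC alg_mpolyC; exists c.
Qed.

(** This is where [F] has to be large.  If no [X_l - c] were in [Q], each of them would
    divide a power of [g] modulo [Q], with a cofactor [q c].  Infinitely many [c] share this
    power and the size of [q c], so that some of the [q c] are linearly dependent; clearing
    the denominators [X_l - c] in this relation gives a nonzero polynomial in [X_l] alone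
    that lies in [Q], and one of its linear factors then lies in [Q]. *)
Lemma prime_ideal_variable (Q : S -> Prop) g (l : 'I_n) :
  infinite_fibres F ->
  prime_ideal Q -> ~ Q g ->
  (forall h, ~ Q h -> exists N q, Q (q * h - g ^+ N)) ->
  exists c, Q ('X_l - c%:MP).
Proof.
move=> Funcountable PQ Qg Qmax; have [IQ Q1 QM] := PQ.
apply: contrapT => /forallNP Qc.
have /choice[Nq QNq] c : exists Nq : nat * S,
    Q (Nq.2 * ('X_l - c%:MP) - g ^+ Nq.1).
  by have [N [q]] := Qmax _ (Qc c); exists (N, q).
have [k kP] := Funcountable (fun c => pickle ((Nq c).1, msize (Nq c).2)).
(* The power of [g] and the size of the cofactor that are shared along the fibre [k]. *)
pose NK := odflt (0%N, 0%N) (unpickle k).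
have [s us [sz sk]] := kP #|{: 'X_{1..n < NK.2}}|.+1.
have {}sk c : c \in s -> (Nq c).1 = NK.1 /\ msize (Nq c).2 = NK.2.
  by move=> /sk kE; rewrite /NK -kE pickleK.
pose c (r : 'I_(size s)) := s`_r.
have cs r : c r \in s by exact: mem_nth.
have [||la [r0 la0] rel] :=
    @linear_relation_of_msize NK.2 (size s) (fun r => (Nq (c r)).2).
- by rewrite sz.
- by move=> r; rewrite (sk _ (cs r)).2.
pose cof r : {poly F} := \prod_(t | t != r) ('X - (c t)%:P).
pose E := \sum_r la r *: cof r.
(* Lagrange interpolation: at the node [c r0] only the term of index [r0] survives. *)
have E0 : E != 0.
  apply/eqP => /(congr1 (fun p => p.[c r0])) /eqP; apply/negP.
  rewrite horner0 /E horner_sum (bigD1 r0) //= big1 => [|r rr0].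
    rewrite addr0 hornerZ mulf_neq0 // horner_prod.
    apply/prodf_neq0 => t tr0; rewrite hornerXsubC subr_eq0.
    by rewrite nth_uniq // eq_sym.
  rewrite hornerZ horner_prod (bigD1 r0) 1?eq_sym //=.
  by rewrite hornerXsubC subrr mul0r mulr0.
have evXc r : horner_alg ('X_l : S) ('X - (c r)%:P) = 'X_l - (c r)%:MP.
  by rewrite rmorphB /= horner_algX horner_algC alg_mpolyC.
have : Q (g ^+ NK.1 * horner_alg ('X_l : S) E).
  pose Pi : S := \prod_r ('X_l - (c r)%:MP).
  suff : Q (Pi * (\sum_r la r *: (Nq (c r)).2)
            - g ^+ NK.1 * horner_alg ('X_l : S) E).
    by rewrite rel mulr0 sub0r => /(idealN IQ); rewrite opprK.
  rewrite /E linear_sum !mulr_sumr -sumrB; apply: (ideal_sum _ IQ) => r _.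
  rewrite linearZ /= alg_mpolyC -mul_mpolyC mulrCA [X in _ - X]mulrCA -mulrBr.
  apply: (ideal_mull _ IQ).
  rewrite /Pi (bigD1 r) //= /cof rmorph_prod /=.
  under [X in _ - _ * X]eq_bigr => t _ do rewrite evXc.
  have := QNq (c r); rewrite (sk _ (cs r)).1.
  move=> /(ideal_mull (\prod_(t | t != r) ('X_l - (c t)%:MP)) IQ).
  by congr (Q _); ring.
move=> /QM[/(primeX PQ)//|]; move=> /(prime_ideal_linear_factor PQ E0)[d].
exact: Qc.
Qed.

(** A prime ideal that contains [J] but not [g], maximal among the ideals avoiding the
    powers of [g], contains all [X_l - c_l] for a suitable point [c]; this [c] is a zero of
    [J] at which [g] does not vanish. *)
Lemma nullstellensatz (J : S -> Prop) g :
  infinite_fibres F ->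
  is_ideal J ->
  (forall z, (forall h, J h -> h.@[z] = 0) -> g.@[z] = 0) ->
  exists N, J (g ^+ N).
Proof.
move=> Funcountable IJ Jg; apply: contrapT => /forallNP.
move=> /(prime_avoiding_powers IJ)[Q [PQ JQ Qg Qmax]]; have [IQ Q1 _] := PQ.
have /choice[c Qc] l := prime_ideal_variable l Funcountable PQ Qg Qmax.
have Qev := eval_mod_ideal IQ Qc.
apply: Qg; apply: (ideal_subr IQ (Qev g)); rewrite Jg; first exact: (ideal0 IQ).
move=> h /JQ Qh; apply/eqP/negP => /negP hc0; apply: Q1.
rewrite (_ : 1 = (h.@[c])^-1%:MP * (h.@[c])%:MP).
  by apply: (ideal_mull _ IQ); exact: (ideal_subl IQ (Qev h)).
by rewrite -mpolyCM mulVf.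
Qed.

End Nullstellensatz.

(** * Uncountability of the complex numbers *)

Section Uncountable.
Variable R : realType.
Local Open Scope classical_set_scope.

(** Cantor's nested intervals: the interval [J n.+1] avoids the point numbered [n], and the
    supremum of the left ends lies in all of them. *)
Lemma real_uncountable : ~ countable [set: R].
Proof.
move=> /countable_injP[num /in2TT num_inj].
have avoid (n : nat) (I : R * R) : exists I' : R * R, I.1 < I.2 ->
    [/\ I.1 <= I'.1, I'.1 < I'.2, I'.2 <= I.2 &
        forall x, I'.1 <= x <= I'.2 -> num x != n].
  have [[x xn]|nox] := pselect (exists x, num x = n); last first.
    exists I => ltI; split => // x _; by apply/eqP => xn; apply: nox; exists x.
  have numn y : y != x -> num y != n by rewrite -xn (inj_eq num_inj).
  have [xmid|midx] := ltP x ((I.1 + I.2) / 2).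
    exists ((I.1 + I.2) / 2, I.2) => ltI; rewrite midf_le ?midf_lt ?lexx ?(ltW ltI) //.
    by split=> // y /andP[y1 _]; apply: numn; rewrite gt_eqF // (lt_le_trans xmid).
  pose mid := (I.1 + (I.1 + I.2) / 2) / 2.
  exists (I.1, mid) => ltI; have ltm : I.1 < (I.1 + I.2) / 2 by rewrite midf_lt.
  have ltmid : mid < (I.1 + I.2) / 2 by rewrite midf_lt.
  split => //=; first by rewrite midf_lt.
    by apply/ltW/(lt_trans ltmid); rewrite midf_lt.
  by move=> y /andP[_ ym]; apply: numn; rewrite lt_eqF //
    (le_lt_trans ym) // (lt_le_trans ltmid).
have [next nextP] := choice (fun nI : nat * (R * R) => avoid nI.1 nI.2).
pose J := fix J n : R * R := if n is n'.+1 then next (n', J n') else (0, 1).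
have ltJ n : (J n).1 < (J n).2.
  by elim: n => [|n IHn] /=; [exact: ltr01 | case: (nextP (n, J n) IHn)].
have nest n n' : (n <= n')%N -> (J n).1 <= (J n').1 /\ (J n').2 <= (J n).2.
  elim: n' => [|n' IHn']; first by rewrite leqn0 => /eqP ->.
  rewrite leq_eqVlt => /orP[/eqP -> //|/IHn'[h1 h2]].
  have [h1' _ h2' _] := nextP (n', J n') (ltJ n').
  by split; [exact: le_trans h1 h1' | exact: le_trans h2' h2].
have left_le_right n n' : (J n).1 <= (J n').2.
  have [/nest[h _]|/ltnW/nest[_ h]] := leqP n n'.
    exact: le_trans h (ltW (ltJ n')).
  exact: le_trans (ltW (ltJ n)) h.
pose x := sup (range (fun n => (J n).1)).
have xJ n : (J n).1 <= x <= (J n).2.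
  apply/andP; split.
    apply: ub_le_sup; last by exists n.
    by exists (J 0%N).2 => _ [n' _ <-].
  by apply: ge_sup; [exists (J 0%N).1, 0%N | move=> _ [n' _ <-]].
have [_ _ _ /(_ x (xJ (num x).+1))] := nextP (num x, J (num x)) (ltJ (num x)).
by rewrite eqxx.
Qed.

(** Otherwise the real line would be a countable union of finite sets. *)
Lemma complex_infinite_fibres : infinite_fibres R[i].
Proof.
move=> kappa; pose fibre k : set R := fun x => kappa (x%:C)%C = k.
have [k infk] : exists k, infinite_set (fibre k).
  apply/not_existsP => fin_fibre; apply: real_uncountable.
  rewrite (_ : setT = \bigcup_(k in [set: nat]) fibre k).
    apply: bigcup_countable => // k _; apply: finite_set_countable.
    by apply: contrapT; exact: fin_fibre.
  by apply/seteqP; split => // x _; exists (kappa (x%:C)%C).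
exists k => N.
have [B Bk sB] := infinite_set_fset N infk.
exists (map (fun x : R => (x%:C)%C) (take N (finmap.enum_fset B))).
  rewrite map_inj_uniq ?take_uniq ?finmap.fset_uniq //; exact: complexI.
rewrite size_map size_takel //; split => // _ /mapP[x /mem_take xB ->].
exact: Bk.
Qed.
End Uncountable.

(** * Functions vanishing along a formal integral curve *)

Section DifferentialIdeal.
Variables (A : comNzRingType) (F : numFieldType) (ev : {rmorphism A -> F}).
Variable X : A -> A.
Hypothesis XD : {morph X : g h / g + h}.
Hypothesis XM : forall g h, X (g * h) = X g * h + g * X h.

(** [ev (iter k X h)] is, up to the factor [k!], the [k]-th Taylor coefficient of [h] along
    the formal integral curve of [X] through the point [ev]: these are the functions that
    vanish on this curve. *)
Definition flow_ideal (h : A) : Prop := forall k, ev (iter k X h) = 0.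

Lemma derivation0 : X 0 = 0.
Proof. by have /eqP := XD 0 0; rewrite addr0 -subr_eq subrr => /eqP. Qed.

Lemma derivationMn g k : X (g *+ k) = X g *+ k.
Proof. by elim: k => [|k IHk]; rewrite ?mulr0n ?derivation0 // !mulrS XD IHk. Qed.

Lemma iter_derivationD k : {morph iter k X : g h / g + h}.
Proof. by elim: k => // k IHk g h /=; rewrite IHk XD. Qed.

Lemma iter_derivationM k g h : iter k X (g * h) =
  \sum_(i < k.+1) (iter i X g * iter (k - i) X h) *+ 'C(k, i).
Proof.
elim: k => [|k IHk]; rewrite big_ord_recl /= ?big_ord0 ?addr0 ?bin0 ?mulr1n //.
rewrite {}IHk (big_morph X XD derivation0).
under eq_bigr => i _ do rewrite derivationMn XM mulrnDl.
rewrite big_split /= [X in X + _]big_ord_recr [X in _ + X]big_ord_recl /=.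
rewrite subnn bin0 binn !mulr1n subn0 addrCA; congr (_ + _).
rewrite [in RHS]big_ord_recr /= subSS subnn binn mulr1n addrAC.
rewrite -big_split /=; congr (_ + _); apply: eq_bigr => i _.
by rewrite /bump leq0n add0n add1n subSS -!iterS subnSK // binS mulrnDr addrC.
Qed.

Lemma flow_idealP : is_ideal flow_ideal.
Proof.
split=> [k|g h Ig Ih k|c h Ih k].
- by elim: k => [|k IHk] /=; rewrite ?rmorph0 // -iterS iterSr derivation0.
- by rewrite iter_derivationD rmorphD /= Ig Ih addr0.
- rewrite iter_derivationM rmorph_sum /= big1 // => i _.
  by rewrite rmorphMn rmorphM /= Ih mulr0 mul0rn.
Qed.

Lemma flow_ideal_stable h : flow_ideal h -> flow_ideal (X h).
Proof. by move=> Ih k; rewrite -iterSr. Qed.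

Lemma flow_ideal_ev h : flow_ideal h -> ev h = 0.
Proof. by move=> /(_ 0%N). Qed.

(** In characteristic zero the leading Taylor coefficient of a product is a nonzero
    multiple of the product of the leading coefficients. *)
Lemma flow_ideal_prime : prime_ideal flow_ideal.
Proof.
split; first exact: flow_idealP.
  by move=> /flow_ideal_ev /eqP; rewrite rmorph1 oner_eq0.
have order h : ~ flow_ideal h -> exists2 a, ev (iter a X h) != 0 &
    forall i, (i < a)%N -> ev (iter i X h) = 0.
  move=> /existsNP[k /eqP hk].
  have [a ha mina] := ex_minnP (ex_intro (fun k => ev (iter k X h) != 0) k hk).
  exists a => // i; rewrite ltnNge; apply: contraNeq; exact: mina.
move=> g h Igh; apply: contrapT => /not_orP[/order[a ga ga0] /order[b hb hb0]].
have /eqP := Igh (a + b)%N; apply/negP.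
rewrite iter_derivationM rmorph_sum /=.
have ltab : (a < (a + b).+1)%N by rewrite ltnS leq_addr.
rewrite (bigD1 (Ordinal ltab)) //= big1 => [|i ia].
  rewrite addr0 addKn rmorphMn rmorphM /= mulrn_eq0 negb_or -lt0n bin_gt0 leq_addr.
  by rewrite mulf_neq0.
rewrite rmorphMn rmorphM /=; have [lia|lai] := ltnP i a.
  by rewrite ga0 // mul0r mul0rn.
have {lai ia} lai : (a < i)%N by rewrite ltn_neqAle eq_sym ia.
by rewrite hb0 ?mulr0 ?mul0rn //; have := ltn_ord i; lia.
Qed.

End DifferentialIdeal.

(** * Weighted homogeneous polynomials *)

Section WeightedHomogeneous.
Variables (R : realType) (n : nat) (w : 'I_n.+1 -> nat).
Local Notation C := R[i].
Local Notation S := {mpoly C[n.+1]}.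
Implicit Types (p q : S) (k l : int) (m : 'X_{1..n.+1}).

Definition wdeg m : int := (\sum_(i < n.+1) w i * m i)%N%:Z.

Lemma wdegD m1 m2 : wdeg (m1 + m2)%MM = wdeg m1 + wdeg m2.
Proof.
rewrite /wdeg -PoszD -big_split /=; congr Posz; apply: eq_bigr => i _.
by rewrite mnmDE mulnDr.
Qed.

Lemma wdegU i : wdeg U_(i)%MM = (w i)%:Z.
Proof.
rewrite /wdeg (bigD1 i) //= mnm1E eqxx muln1 big1 ?addn0 // => j ji.
by rewrite mnm1E eq_sym (negbTE ji) muln0.
Qed.

Lemma whomog_coeff k p m : whomog w k p -> p@_m != 0 -> wdeg m = k.
Proof. by move=> pk pm; apply: pk; rewrite mcoeff_msupp. Qed.

Lemma coeff_whomog k p : (forall m, p@_m != 0 -> wdeg m = k) -> whomog w k p.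
Proof. by move=> pk m; rewrite mcoeff_msupp => /pk. Qed.

Lemma whomog0 k : whomog w k (0 : S).
Proof. by apply: coeff_whomog => m; rewrite mcoeff0 eqxx. Qed.

Lemma whomogX m : whomog w (wdeg m) ('X_[m] : S).
Proof. by apply: coeff_whomog => l; rewrite mcoeffX; case: (m =P l) => [->|]; rewrite ?eqxx. Qed.

Lemma whomogXU i : whomog w (w i)%:Z ('X_i : S).
Proof. by rewrite -wdegU; exact: whomogX. Qed.

Lemma whomogC c : whomog w 0 (c%:MP : S).
Proof.
apply: coeff_whomog => m; rewrite mcoeffC; case: (m =P 0%MM) => [->|]; last first.
  by rewrite mulr0 eqxx.
by rewrite /wdeg big1 // => i _; rewrite mnm0E muln0.
Qed.

Lemma whomogD k p q : whomog w k p -> whomog w k q -> whomog w k (p + q).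
Proof.
move=> pk qk; apply: coeff_whomog => m; rewrite mcoeffD => pqm.
have [pm|pm] := eqVneq p@_m 0; last exact: whomog_coeff pm.
by apply: (whomog_coeff qk); rewrite pm add0r in pqm.
Qed.

Lemma whomog_sum k (I : Type) (r : seq I) (K : pred I) (f : I -> S) :
  (forall i, K i -> whomog w k (f i)) -> whomog w k (\sum_(i <- r | K i) f i).
Proof.
by move=> fk; apply: big_ind => //; [exact: whomog0 | move=> ? ?; exact: whomogD].
Qed.

Lemma whomogM k l p q : whomog w k p -> whomog w l q -> whomog w (k + l) (p * q).
Proof.
move=> pk ql m /msuppM_le /allpairsP[[m1 m2] /= [pm1 qm2 ->]].
by rewrite [LHS]wdegD; congr (_ + _); [exact: pk | exact: ql].
Qed.

Lemma whomogZ k c p : whomog w k p -> whomog w k (c *: p).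
Proof. by move=> pk; rewrite -mul_mpolyC -[k]add0r; apply: whomogM => //; exact: whomogC. Qed.

Lemma whomogN k p : whomog w k p -> whomog w k (- p).
Proof. by rewrite -scaleN1r; exact: whomogZ. Qed.

Lemma whomogXn k p (N : nat) : whomog w k p -> whomog w (k * N%:Z) (p ^+ N).
Proof.
move=> pk; elim: N => [|N IHN]; first by rewrite mulr0; exact: whomogC.
by rewrite exprS intS mulrDr mulr1; exact: whomogM.
Qed.

Lemma whomog_prod (I : Type) (r : seq I) (k : I -> int) (f : I -> S) :
  (forall i, whomog w (k i) (f i)) ->
  whomog w (\sum_(i <- r) k i) (\prod_(i <- r) f i).
Proof.
move=> fk; elim: r => [|i r IHr]; first by rewrite !big_nil; exact: whomogC.
by rewrite !big_cons; exact: whomogM.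
Qed.

Lemma whomog_deriv k i p : whomog w k p -> whomog w (k - (w i)%:Z) p^`M(i).
Proof.
move=> pk; apply: coeff_whomog => m; rewrite mcoeff_deriv => pm.
have : p@_(m + U_(i)) != 0 by apply: contraNneq pm => ->; rewrite mul0rn.
by move=> /(whomog_coeff pk) <-; rewrite wdegD wdegU addrK.
Qed.

(** Every term of the Leibniz expansion has the degree of the product of the diagonal
    entries. *)
Lemma whomog_det N (B : 'M[S]_N) (rho kap : 'I_N -> int) :
  (forall i j, whomog w (rho i - kap j) (B i j)) ->
  whomog w (\sum_i rho i - \sum_i kap i) (\det B).
Proof.
move=> hB; apply: whomog_sum => s _.
rewrite mulr_sign; case: ifP => _; first apply: whomogN.
all: rewrite [X in _ - X](reindex_inj (@perm_inj _ s)) -sumrB; exact: whomog_prod.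
Qed.

Lemma whomog_msize (k : nat) p : (forall i, (0 < w i)%N) ->
  whomog w k%:Z p -> (msize p <= k.+1)%N.
Proof.
move=> w0 pk; rewrite msizeE; apply/bigmax_leqP_seq => m /pk [<-] _.
by rewrite ltnS mdegE leq_sum // => i _; rewrite leq_pmull.
Qed.

(** The homogeneous component of weighted degree [k]. *)
Definition wcomp k p : S := \sum_(m <- msupp p | wdeg m == k) p@_m *: 'X_[m].

Lemma mcoeff_wcomp k p m : (wcomp k p)@_m = if wdeg m == k then p@_m else 0.
Proof.
rewrite /wcomp raddf_sum /=.
under eq_bigr => l _ do rewrite mcoeffZ mcoeffX.
have [pm|pm] := boolP (m \in msupp p); last first.
  rewrite (memN_msupp_eq0 pm) if_same big1_seq // => l /andP[_ lp].
  by case: eqP => [lm|]; rewrite ?mulr0 // -lm lp in pm *.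
rewrite -big_filter; case: ifP => mk.
  rewrite (bigD1_seq m) ?filter_uniq ?msupp_uniq ?mem_filter ?mk //= eqxx mulr1.
  by rewrite big1 ?addr0 // => l /negbTE ->; rewrite mulr0.
rewrite big1_seq // => l /andP[_]; rewrite mem_filter => /andP[lk _].
by case: eqP => [lm|]; rewrite ?mulr0 // -lm lk in mk *.
Qed.

Lemma whomog_wcomp k p : whomog w k (wcomp k p).
Proof.
by apply: coeff_whomog => m; rewrite mcoeff_wcomp; case: (wdeg m =P k); rewrite ?eqxx.
Qed.

Lemma wcomp_id k p : whomog w k p -> wcomp k p = p.
Proof.
move=> pk; apply/mpolyP => m; rewrite mcoeff_wcomp; case: eqP => // /eqP mk.
by apply/esym/eqP; apply: contraNT mk => /(whomog_coeff pk) ->.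
Qed.

Lemma wcompD k : {morph wcomp k : p q / p + q}.
Proof.
move=> p q; apply/mpolyP => m; rewrite mcoeffD !mcoeff_wcomp mcoeffD.
by case: ifP; rewrite ?addr0.
Qed.

Lemma wcomp0 k : wcomp k 0 = 0.
Proof. by rewrite /wcomp msupp0 big_nil. Qed.

Lemma wcompM k l p q : whomog w l p -> wcomp k (p * q) = p * wcomp (k - l) q.
Proof.
move=> pl; apply/mpolyP => m; rewrite mcoeff_wcomp.
have [K mK] : exists K, (mdeg m < K)%N by exists (mdeg m).+1.
rewrite !(mcoeff_poly_mul _ _ mK).
case: ifP => mk; last apply/esym.
  apply: eq_bigr => m12 /eqP Em; rewrite mcoeff_wcomp.
  have [->|pm] := eqVneq p@_(m12.1) 0; first by rewrite !mul0r.
  by rewrite -(eqP mk) Em wdegD (whomog_coeff pl pm) addrAC subrr add0r eqxx.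
rewrite big1 // => m12 /eqP Em; rewrite mcoeff_wcomp.
have [->|pm] := eqVneq p@_(m12.1) 0; first by rewrite !mul0r.
case: eqP => [mk2|]; last by rewrite mulr0.
by move: mk; rewrite Em wdegD mk2 (whomog_coeff pl pm) addrC subrK eqxx.
Qed.

Lemma mulX_mderivX i m : 'X_i * ('X_[m])^`M(i) = (m i)%:R * 'X_[m] :> S.
Proof.
rewrite mderivX -scalerAr -mpolyXD scaler_nat -[LHS]mulr_natl.
have [->|mi] := posnP (m i); first by rewrite !mul0r.
congr (_ * _); congr ('X_[_]); rewrite addmC submK //; apply/mnm_lepP => j.
by rewrite mnm1E; case: eqP => [<-|].
Qed.

Lemma whomog_euler k p : whomog w k p ->
  \sum_(i < n.+1) (w i)%:R * 'X_i * p^`M(i) = k%:~R * p.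
Proof.
move=> pk; rewrite {1 2}(mpolyE p).
under eq_bigr => i _ do rewrite linear_sum mulr_sumr.
rewrite exchange_big mulr_sumr /= !big_seq; apply: eq_bigr => m /pk <-.
under eq_bigr => i _ do
  rewrite mderivZ -scalerAr -mulrA mulX_mderivX mulrA -natrM.
by rewrite -scaler_sumr -mulr_suml -natr_sum -scalerAr.
Qed.

End WeightedHomogeneous.

(** * Minors *)

Section Minors.
Variable A : comNzRingType.

Definition unit_rows (n : nat) (i k : 'I_n) : 'M[A]_(2, n) :=
  \matrix_(b, c) (c == if b == 0 then i else k)%:R.

Lemma det_mx2 (B : 'M[A]_2) : \det B = B 0 0 * B 1 1 - B 0 1 * B 1 0.
Proof.
rewrite (expand_det_row _ 0) 2!big_ord_recl big_ord0 addr0 /cofactor !det_mx11 !mxE.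
have -> : lift ord0 ord0 = 1 :> 'I_2 by exact/val_inj.
have -> : lift 1 0 = 0 :> 'I_2 by exact/val_inj.
by rewrite expr0 expr1 mul1r mulN1r mulrN.
Qed.

(** If [x] and [r] are in the kernel of [J], the minors of the matrix with columns [x], [r]
    are proportional to the complementary maximal minors of [J], and the factor of
    proportionality can be read off from any fixed pair [i], [k].  Indeed, multiply the
    square matrix obtained by putting two unit rows on top of [J] by the square matrix with
    columns [x], [r] and the unit columns selected by [s]: modulo [I] the product is block
    upper triangular, with diagonal blocks of determinants [x i * r k - x k * r i] and
    [\det (colsub s J)]. *)
Lemma bordered_minor_mod_ideal (I : A -> Prop) (m : nat) (J : 'M[A]_(m, 2 + m))
    (x r : 'I_(2 + m) -> A) (i k : 'I_(2 + m)) (s : 'I_m -> 'I_(2 + m)) :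
  is_ideal I -> (forall j, I (\sum_c J j c * x c)) ->
  (forall j, I (\sum_c J j c * r c)) ->
  exists D, I ((x i * r k - x k * r i) * \det (colsub s J)
               - \det (col_mx (unit_rows i k) J) * D).
Proof.
move=> II Jx Jr.
pose XR : 'M[A]_(2 + m, 2) := \matrix_(c, b) if b == 0 then x c else r c.
pose U : 'M[A]_(2 + m, m) := \matrix_(c, j) (c == s j)%:R.
have JU : J *m U = colsub s J.
  apply/matrixP => j l; rewrite !mxE (bigD1 (s l)) //= mxE eqxx mulr1.
  by rewrite big1 ?addr0 // => c /negbTE cs; rewrite mxE cs mulr0.
have EXR b b' : (unit_rows i k *m XR) b b' = XR (if b == 0 then i else k) b'.
  rewrite mxE (bigD1 (if b == 0 then i else k)) //= mxE eqxx mul1r.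
  by rewrite big1 ?addr0 // => c /negbTE cs; rewrite mxE cs mul0r.
exists (\det (row_mx XR U)); rewrite -det_mulmx mul_col_row JU.
rewrite (_ : x i * r k - x k * r i = \det (unit_rows i k *m XR)); last first.
  by rewrite det_mx2 !EXR !mxE /=; ring.
rewrite -(det_ublock _ (unit_rows i k *m U)).
apply: ideal_det => // b c; rewrite -(fintype.splitK b) -(fintype.splitK c).
case: (fintype.split b) => b'; case: (fintype.split c) => c' /=; rewrite ?block_mxEul ?block_mxEur
  ?block_mxEdl ?block_mxEdr ?subrr; try exact: ideal0.
rewrite !mxE sub0r; apply: (idealN II).
rewrite [X in I X](_ : _ = \sum_c J b' c * if c' == 0 then x c else r c).
  by case: (c' == 0).
by apply: eq_bigr => t _; rewrite mxE.
Qed.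

End Minors.

Lemma full_rank_minor (F : fieldType) (m n : nat) (B : 'M[F]_(m, n)) :
  \rank B = m -> exists s : 'I_m -> 'I_n, \det (colsub s B) != 0.
Proof.
move=> rB; have fB : row_full B^T by rewrite /row_full mxrank_tr rB.
exists (mxalgebra.fullrankfun fB).
have := fullrowsub_unit fB; rewrite unitmxE unitfE.
by rewrite -det_tr; congr (\det _ != 0); apply/matrixP => i j; rewrite !mxE.
Qed.

(** * Polynomial vector fields *)

Section VectorField.
Variables (R : realType) (n : nat) (P : 'I_n.+1 -> {mpoly R[i][n.+1]}).
Local Notation S := {mpoly R[i][n.+1]}.
Local Notation X := (vfield_apply P).

Lemma vfieldD : {morph X : g h / g + h}.
Proof.
move=> g h; rewrite /vfield_apply -big_split; apply: eq_bigr => i _.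
by rewrite mderivD mulrDr.
Qed.

Lemma vfieldM g h : X (g * h) = X g * h + g * X h.
Proof.
rewrite /vfield_apply mulr_suml mulr_sumr -big_split; apply: eq_bigr => i _ /=.
by rewrite mderivM; ring.
Qed.

Lemma vfieldZ c g : X (c *: g) = c *: X g.
Proof.
by rewrite /vfield_apply scaler_sumr; apply: eq_bigr => i _; rewrite mderivZ scalerAr.
Qed.

Lemma vfield0 : X 0 = 0.
Proof. exact: (derivation0 vfieldD). Qed.

Lemma vfieldC c : X c%:MP = 0.
Proof. by rewrite /vfield_apply big1 // => i _; rewrite mderivC mulr0. Qed.

Lemma vfieldXU i : X 'X_i = P i.
Proof.
rewrite /vfield_apply (bigD1 i) //= big1 => [|j ji].
  by rewrite mderivX mnm1E eqxx scale1r -{1}[U_(i)%MM]add0m addmK mpolyX0 mulr1 addr0.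
by rewrite mderivX mnm1E eq_sym (negbTE ji) scale0r mulr0.
Qed.

Lemma vfieldXn g N : X (g ^+ N) = N%:R * g ^+ N.-1 * X g.
Proof.
elim: N => [|N IHN]; first by rewrite expr0 -mpolyC1 vfieldC !mul0r.
rewrite exprS vfieldM {}IHN /= -natr1; case: N => [|N] /=; first by rewrite expr0; ring.
by rewrite !exprS; ring.
Qed.

(** If the derivative of [u / v] along [X] is nonzero modulo the prime ideal [I], then
    [u / v] is transcendental over the constants: applying [X] to an algebraic relation
    homogenized by [v], and subtracting a multiple of it, gives a relation of lower
    degree. *)
Lemma monomials_independent (I : S -> Prop) (u v : S) :
  prime_ideal I -> (forall h, I h -> I (X h)) ->
  ~ I v -> ~ I (v * X u - u * X v) ->
  forall (M : nat) (l : nat -> R[i]),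
  I (\sum_(r < M.+1) l r *: (u ^+ r * v ^+ (M - r))) ->
  forall r, (r <= M)%N -> l r = 0.
Proof.
move=> PI IX Iv Iuv; have [II I1 IM] := PI.
have const c : I c%:MP -> c = 0.
  move=> Ic; apply/eqP/negP => /negP c0; apply: I1.
  by rewrite -mpolyC1 -(mulVf c0) mpolyCM; exact: (ideal_mull _ II).
(* Opaque names for [X u] and [X v], which would otherwise be unfolded as sums. *)
have [Du EDu] : exists Du, Du = X u by exists (X u).
have [Dv EDv] : exists Dv, Dv = X v by exists (X v).
move: Iuv; rewrite -EDu -EDv => Iuv.
elim=> [|M IHM] l Il.
  case=> // _; apply: const; move: Il.
  by rewrite big_ord1 !expr0 mulr1 -mul_mpolyC mulr1.
have lS r : (r <= M)%N -> l r.+1 = 0.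
  suff Il' : I (\sum_(r < M.+1) (r.+1%:R * l r.+1) *: (u ^+ r * v ^+ (M - r))).
    by move=> /(IHM (fun r => r.+1%:R * l r.+1) Il')/eqP; rewrite mulf_eq0 pnatr_eq0 => /eqP.
  suff /IM[] : I ((v * Du - u * Dv) *
            \sum_(r < M.+1) (r.+1%:R * l r.+1) *: (u ^+ r * v ^+ (M - r))) by [].
  have := idealB II (ideal_mull v II (IX _ Il)) (ideal_mull (M.+1%:R * Dv) II Il).
  congr (I _); rewrite (big_morph _ vfieldD vfield0) !mulr_sumr -sumrB.
  rewrite big_ord_recl [X in X + _](_ : _ = 0) ?add0r.
    apply: eq_bigr => {}r _; rewrite lift0 subSS vfieldZ vfieldM !vfieldXn -EDu -EDv /=.
    have [rM|Mr] := ltnP r M; last first.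
      have -> : nat_of_ord r = M by have := ltn_ord r; lia.
      rewrite subnn expr0 !exprS -!mul_mpolyC mpolyCM mpolyC_nat; ring.
    have -> : (M - r = (M - r.+1).+1)%N by lia.
    have -> : M.+1%:R = ((M - r.+1).+1 + r.+1)%:R :> S by congr (_%:R); lia.
    rewrite natrD /= !exprS -!mul_mpolyC mpolyCM mpolyC_nat; ring.
  rewrite /= vfieldZ expr0 mul1r subn0 vfieldXn -EDv /= exprS -!mul_mpolyC; ring.
case=> [|r] => [_|]; last exact: lS.
move: Il; rewrite big_ord_recl big1 => [|r _]; last by rewrite lift0 lS ?scale0r // -ltnS.
rewrite addr0 expr0 mul1r subn0 -mul_mpolyC => /IM[/const//|/(primeX PI)//].
Qed.
End VectorField.

(** * The degree of a foliation tangent to a smooth curve *)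

Section FoliatedCurve.
Variables (R : realType) (m : nat) (w : 'I_m.+2 -> nat).
Local Notation C := R[i].
Local Notation S := {mpoly C[m.+2]}.
Variables (a : 'I_m -> nat) (f : 'I_m -> S) (d : int) (P : 'I_m.+2 -> S).
Hypothesis w_gt0 : forall i, (0 < w i)%N.
Hypothesis f_homog : forall j, whomog w (a j)%:Z (f j).
Hypothesis f_smooth : forall z, @curve R m.+1 f z -> \rank (@jacobian R m.+1 f z) = m.
Hypothesis P_homog : forall i, whomog w (d + (w i)%:Z) (P i).
Hypothesis P_tangent : forall j, @in_ideal R m.+1 f (vfield_apply P (f j)).

Local Notation X := (vfield_apply P).
Local Notation fI := (@in_ideal R m.+1 f).

Definition jacobian_poly : 'M[S]_(m, 2 + m) := \matrix_(j, i) (f j)^`M(i).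

(** The [(i, k)] coefficient of the bivector field [X /\ R], where [R] is the radial vector
    field. *)
Definition wedge (i k : 'I_m.+2) : S :=
  P i * ((w k)%:R * 'X_k) - P k * ((w i)%:R * 'X_i).

(** Up to sign, the maximal minor of the Jacobian matrix obtained by deleting the columns
    [i] and [k]; the bordered form makes its sign and its degree uniform in [i], [k]. *)
Definition bordered_jacobian (i k : 'I_m.+2) : S :=
  \det (col_mx (unit_rows S i k) jacobian_poly).

(** The weighted degree of [wedge i k / bordered_jacobian i k]. *)
Definition excess : int := d + \sum_i (w i)%:Z - \sum_j (a j)%:Z.

Lemma in_idealP : is_ideal fI.
Proof.
split.
- by exists (fun=> 0); rewrite big1 // => j _; rewrite mul0r.
- move=> _ _ [g ->] [h ->]; exists (fun j => g j + h j).
  by rewrite -big_split; apply: eq_bigr => j _; rewrite mulrDl.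
- move=> c _ [h ->]; exists (fun j => c * h j).
  by rewrite mulr_sumr; apply: eq_bigr => j _; rewrite mulrA.
Qed.

Lemma in_ideal_gen j : fI (f j).
Proof.
exists (fun l => (l == j)%:R); rewrite (bigD1 j) //= eqxx mul1r big1 ?addr0 //.
by move=> l /negbTE ->; rewrite mul0r.
Qed.

Lemma in_ideal_wcomp k h : fI h -> fI (wcomp w k h).
Proof.
case=> g ->; rewrite (big_morph _ (@wcompD _ _ w k) (@wcomp0 _ _ w k)).
apply: (ideal_sum _ in_idealP) => j _.
by rewrite mulrC (wcompM _ _ (@f_homog j)); exact: (ideal_mulr _ in_idealP (in_ideal_gen j)).
Qed.

Lemma in_ideal_eval z h : @curve R m.+1 f z -> fI h -> h.@[z] = 0.
Proof.
move=> [_ fz] [g ->]; rewrite raddf_sum /= big1 // => j _.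
by rewrite mevalM [_.@[z] in X in _ * X]fz ?mulr0 //; exists j.
Qed.

Lemma in_ideal_vfield h : fI h -> fI (X h).
Proof.
case=> g ->; rewrite (big_morph _ (vfieldD P) (vfield0 P)).
apply: (ideal_sum _ in_idealP) => j _; rewrite vfieldM.
by apply: (idealD in_idealP); apply: (ideal_mull _ in_idealP);
  [exact: in_ideal_gen | exact: P_tangent].
Qed.

Lemma wedge_homog i k : whomog w (d + (w i)%:Z + (w k)%:Z) (wedge i k).
Proof.
have rad c : whomog w (w c)%:Z ((w c)%:R * 'X_c : S).
  by rewrite -mpolyC_nat mul_mpolyC; apply: whomogZ; exact: whomogXU.
apply: whomogD; first by apply: whomogM.
by apply: whomogN; rewrite -addrA [(w i)%:Z + _]addrC addrA; apply: whomogM.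
Qed.

(** The entry in row [b] and column [c] has degree [rho b - w c], where [rho] is the degree
    of the corresponding equation, or [w i], [w k] for the two unit rows. *)
Lemma bordered_jacobian_homog i k : whomog w
  ((w i)%:Z + (w k)%:Z + \sum_j (a j)%:Z - \sum_c (w c)%:Z) (bordered_jacobian i k).
Proof.
pose rho (b : 'I_(2 + m)) : int := match fintype.split b with
  | inl b => (w (if b == 0 then i else k))%:Z | inr j => (a j)%:Z end.
rewrite (_ : _ + \sum_j (a j)%:Z = \sum_(b < 2 + m) rho b).
  apply: (@whomog_det _ _ _ (2 + m) _ rho (fun c => (w c)%:Z)) => b c.
  rewrite mxE /rho; case: (fintype.split b) => b'; rewrite mxE.
    case: (c =P _) => [->|_]; last exact: whomog0.
    by rewrite subrr -mpolyC1; exact: whomogC.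
  by apply: whomog_deriv; exact: f_homog.
rewrite big_split_ord /= 2!big_ord_recl big_ord0 addr0 /rho.
have sl b : fintype.split (lshift m b) = inl b :> 'I_2 + 'I_m := unsplitK (inl b).
have sr b : fintype.split (rshift 2 b) = inr b :> 'I_2 + 'I_m := unsplitK (inr b).
rewrite !sl /=; congr (_ + _); apply: eq_bigr => j _; by rewrite sr.
Qed.

(** Both [X], by tangency, and the radial field, by Euler's identity, are in the kernel of
    the Jacobian matrix modulo [f]. *)
Lemma wedge_minor_mod_ideal i k (s : 'I_m -> 'I_m.+2) : exists D,
  fI (wedge i k * \det (colsub s jacobian_poly) - bordered_jacobian i k * D).
Proof.
apply: (@bordered_minor_mod_ideal S fI m jacobian_poly P (fun c => (w c)%:R * 'X_c)).
- exact: in_idealP.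
- move=> j; have := P_tangent j; rewrite /vfield_apply; congr (fI _).
  by apply: eq_bigr => c _; rewrite mxE mulrC.
- move=> j; have := ideal_mull (a j)%:R in_idealP (in_ideal_gen j); congr (fI _).
  have := whomog_euler (@f_homog j); rewrite -pmulrn => <-.
  by apply: eq_bigr => c _; rewrite mxE mulrC.
Qed.

Lemma jacobian_poly_eval z (s : 'I_m -> 'I_m.+2) :
  (\det (colsub s jacobian_poly)).@[z] = \det (colsub s (@jacobian R m.+1 f z)).
Proof.
rewrite -det_map_mx; congr (\det _); apply/matrixP => j c; rewrite !mxE //.
Qed.

Section Pair.
Variables i k : 'I_m.+2.

(** The denominator ideal of the rational function
    [g = wedge i k / bordered_jacobian i k] on the cone over the curve. *)
Definition conductor (h : S) : Prop :=
  exists t, fI (wedge i k * h - bordered_jacobian i k * t).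

Lemma conductorP : is_ideal conductor.
Proof.
split.
- by exists 0; rewrite !mulr0 subrr; exact: ideal0 in_idealP.
- move=> g h [s Hs] [t Ht]; exists (s + t).
  by rewrite !mulrDr opprD addrACA; exact: idealD in_idealP Hs Ht.
- move=> c h [t Ht]; exists (c * t).
  by have := ideal_mull c in_idealP Ht; congr (fI _); ring.
Qed.

Lemma in_ideal_conductor h : fI h -> conductor h.
Proof. by move=> fh; exists 0; rewrite mulr0 subr0; exact: ideal_mull in_idealP fh. Qed.

(** All maximal minors of the Jacobian matrix are denominators of [g], and by smoothness they
    have no common zero on the curve. *)
Lemma conductor_power l : exists N, conductor ('X_l ^+ N).
Proof.
apply: nullstellensatz conductorP _; first exact: complex_infinite_fibres.
move=> z zero; rewrite mevalXU; apply/eqP/negP => /negP zl.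
have cz : @curve R m.+1 f z.
  split; first by exists l.
  by move=> _ [j _ <-]; apply: zero; apply: in_ideal_conductor; exact: in_ideal_gen.
have [s /eqP] := full_rank_minor (f_smooth cz); apply.
by rewrite -jacobian_poly_eval; apply: zero; exact: wedge_minor_mod_ideal.
Qed.

(** A monomial of large weighted degree is divisible by a large power of some variable. *)
Lemma conductor_large : exists N, forall (e : nat) u, (N <= e)%N ->
  whomog w e%:Z u -> conductor u.
Proof.
have /choice[N XN] := conductor_power.
exists (\sum_l w l * N l).+1%N => e u Ne ue.
rewrite (mpolyE u) big_seq; apply: (ideal_sum _ conductorP) => mu /ue [mue].
rewrite -mul_mpolyC; apply: (ideal_mull _ conductorP).
have [l Nl] : exists l, (N l <= mu l)%N.
  apply/existsP; apply: contraLR Ne => /existsPn Nmu.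
  rewrite -ltnNge ltnS -mue leq_sum // => l _; rewrite leq_mul2l ltnW ?orbT //.
  by rewrite ltnNge Nmu.
have NU : (U_(l) *+ N l <= mu)%MM.
  by apply/mnm_lepP => c; rewrite mulmnE mnm1E; case: eqP => [<-|]; rewrite ?mul1n.
by rewrite -(submK NU) mpolyXD -mpolyXn; exact: (ideal_mull _ conductorP).
Qed.

(** Multiplication by [g] on the denominators; the quotient is made homogeneous by taking a
    component, which is possible as [f] is homogeneous. *)
Lemma multiplication (e : int) u : whomog w e u -> conductor u ->
  exists2 t, whomog w (e + excess) t & fI (wedge i k * u - bordered_jacobian i k * t).
Proof.
move=> ue [t /(in_ideal_wcomp (d + (w i)%:Z + (w k)%:Z + e)) Ht].
pose e' := d + (w i)%:Z + (w k)%:Z + e -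
    ((w i)%:Z + (w k)%:Z + \sum_j (a j)%:Z - \sum_c (w c)%:Z).
exists (wcomp w e' t).
  rewrite (_ : e + excess = e'); first exact: whomog_wcomp.
  by rewrite /e' /excess; ring.
move: Ht; rewrite wcompD wcomp_id; last by apply: whomogM => //; exact: wedge_homog.
rewrite -mulrN (wcompM _ _ (@bordered_jacobian_homog i k)) -/e'.
rewrite (_ : wcomp w e' (- t) = - wcomp w e' t) ?mulrN //.
by apply/mpolyP => mu; rewrite mcoeffN !mcoeff_wcomp mcoeffN; case: ifP; rewrite ?oppr0.
Qed.

Variable p : 'I_m.+2 -> C.
Hypothesis p_curve : @curve R m.+1 f p.
Hypothesis p_wedge : (wedge i k).@[p] != 0.

Local Notation I := (flow_ideal (meval p) X).

Lemma flow_prime : prime_ideal I.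
Proof. by apply: flow_ideal_prime; [exact: vfieldD | exact: vfieldM]. Qed.

Lemma in_ideal_flow h : fI h -> I h.
Proof.
move=> fh e; apply: in_ideal_eval => //.
by elim: e => //= e IHe; exact: in_ideal_vfield.
Qed.

Lemma wedge_not_flow : ~ I (wedge i k).
Proof. by move=> /flow_ideal_ev /eqP; apply/negP. Qed.

Definition flow_free (M : nat) (u : 'I_M -> S) : Prop :=
  forall l : 'I_M -> C, I (\sum_r l r *: u r) -> forall r, l r = 0.

Lemma variable_not_flow c : (c == i) || (c == k) -> ~ I 'X_c.
Proof.
move=> cik Ic; have [II _ _] := flow_prime; apply: wedge_not_flow.
have IP : I (P c) by have := flow_ideal_stable Ic; rewrite vfieldXU.
by case/orP: cik => /eqP <-; apply: (idealB II);
  do ?[exact: (ideal_mulr _ II)]; do 2 apply: (ideal_mull _ II).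
Qed.

(** The ratio of [X_i^(w k)] and [X_k^(w i)] is not constant along the flow: its derivative
    is [wedge i k] times a monomial, up to its denominator.  Hence there are arbitrarily
    many independent forms of the same degree. *)
Lemma flow_free_monomials (M : nat) : exists2 u : 'I_M.+1 -> S,
  forall r, whomog w (w i * w k * M)%N%:Z (u r) & flow_free u.
Proof.
pose u : S := 'X_i ^+ w k; pose v : S := 'X_k ^+ w i.
have uh : whomog w (w i * w k)%N%:Z u by rewrite PoszM; apply: whomogXn; exact: whomogXU.
have vh : whomog w (w i * w k)%N%:Z v.
  by rewrite mulnC PoszM; apply: whomogXn; exact: whomogXU.
exists (fun r => u ^+ r * v ^+ (M - r)) => [r|l Il r].
  rewrite -{1}[M](subnKC (leq_ord r)) mulnDr PoszD !PoszM -!PoszM.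
  by apply: whomogM; rewrite PoszM; apply: whomogXn.
pose l' (r : nat) := l (inord r).
have := @monomials_independent _ _ P I u v flow_prime (@flow_ideal_stable _ _ _ _).
move=> /(_ _ _ M l'); rewrite -{1}[r]inord_val => indep; apply: indep (leq_ord r).
- by move=> /(primeX flow_prime); apply: variable_not_flow; rewrite eqxx orbT.
- have XS c c' : 'X_c ^+ w c' = 'X_c * 'X_c ^+ (w c').-1 :> S.
    by rewrite -exprS prednK.
  rewrite /u /v !vfieldXn !vfieldXU !XS.
  rewrite (_ : _ - _ = 'X_i ^+ (w k).-1 * 'X_k ^+ (w i).-1 * wedge i k); last first.
    by rewrite /wedge; ring.
  have [_ _ IM] := flow_prime.
  move=> /IM[/IM[]|]; last exact: wedge_not_flow.
  + by move=> /(primeX flow_prime); apply: variable_not_flow; rewrite eqxx.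
  + by move=> /(primeX flow_prime); apply: variable_not_flow; rewrite eqxx orbT.
- by move: Il; congr (I _); apply: eq_bigr => t _; rewrite /l' inord_val.
Qed.

(** Multiplication by [g] is injective on the functions on the integral curve, because
    [wedge i k] does not vanish identically there. *)
Lemma flow_free_step M (e : int) (u : 'I_M -> S) :
  (forall r, whomog w e (u r)) -> (forall r, conductor (u r)) -> flow_free u ->
  exists2 t : 'I_M -> S, forall r, whomog w (e + excess) (t r) & flow_free t.
Proof.
move=> ue uc ufree; have [II _ IM] := flow_prime.
have /choice[t Ht] r : exists t,
    whomog w (e + excess) t /\ fI (wedge i k * u r - bordered_jacobian i k * t).
  by have [t ? ?] := multiplication (ue r) (uc r); exists t.
exists t => [r|l It]; first by have [] := Ht r.
apply: ufree; suff /IM[/wedge_not_flow|] : I (wedge i k * \sum_r l r *: u r) by [].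
apply: (ideal_subr II _ (ideal_mull (bordered_jacobian i k) II It)).
rewrite !mulr_sumr -sumrB; apply: (ideal_sum _ II) => r _.
rewrite -!scalerAr -scalerBr -mul_mpolyC; apply: (ideal_mull _ II).
by apply: in_ideal_flow; have [] := Ht r.
Qed.

(** If [excess] were negative, multiplying an independent family by [g] as long as possible
    would bring it down into degrees smaller than a fixed [N], where the number of monomials
    bounds its length. *)
Lemma excess_ge0 : 0 <= excess.
Proof.
rewrite leNgt; apply/negP => excess_lt0.
have [N0 conductorN] := conductor_large.
(* Above degree [N] the multiplication is defined and its target has degree >= 0. *)
pose N := maxn N0 `|excess|%N.
pose M := #|{: 'X_{1..m.+2 < N}}|.
have [u0 u0h u0free] := flow_free_monomials M.
have [e [u [eN ue ufree]]] : exists (e : nat) (u : 'I_M.+1 -> S),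
    [/\ (e < N)%N, forall r, whomog w e%:Z (u r) & flow_free u].
  have [e0] := ubnP (w i * w k * M)%N.
  elim: e0 (w i * w k * M)%N u0 u0h u0free => // e0 IH e u uh ufree ee0.
  have [eN|Ne] := ltnP e N; first by exists e, u.
  have [|t th tfree] := flow_free_step uh _ ufree.
    by move=> r; apply: conductorN (uh r); rewrite (leq_trans _ Ne) // leq_maxl.
  apply: (IH `|(e%:Z + excess)%R|%N t) => //.
    move=> r; rewrite gez0_abs //; have : (`|excess| <= e)%N.
      by rewrite (leq_trans _ Ne) // leq_maxr.
    by lia.
  have : (`|excess| <= e)%N by rewrite (leq_trans _ Ne) // leq_maxr.
  by lia.
have [||l [r lr] rel] := @linear_relation_of_msize _ _ N M.+1 u.
- exact: ltnSn.
- by move=> r; rewrite (leq_trans (whomog_msize w_gt0 (ue r))).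
- have [II _ _] := flow_prime.
  by move/eqP: lr; apply; apply: ufree; rewrite rel; exact: ideal0.
Qed.

End Pair.
End FoliatedCurve.

Theorem corollary4p1 (R : realType) (n : nat) (hn : (0 < n)%N)
  (w : 'I_n.+1 -> nat) (hw : well_formed w)
  (a : 'I_n.-1 -> nat) (f : 'I_n.-1 -> {mpoly R[i][n.+1]})
  (hC : smooth_complete_intersection_curve w f a)
  (d : int) (P : 'I_n.+1 -> {mpoly R[i][n.+1]})
  (hF : foliation w d P)
  (htangent : tangent_to_curve f P)
  (hCF : ~ subset (curve f) (sing w P)) :
  \sum_(j < n.-1) (a j)%:Z <= d + \sum_(i < n.+1) (w i)%:Z.
Proof.
(* [n = m.+1], so that the [n - 1] equations in [n + 1] variables are [m] equations in
   [m + 2] variables. *)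
case: n hn w hw a f hC P hF htangent hCF => // m _ w [w_gt0 _] a f [_ fh smooth].
move=> P [Ph _] tangent /existsNP[p /not_implyP[cp]].
move=> /not_andP[]; first by case: cp.
move=> /existsNP[i /existsNP[k /eqP q0]].
have /excess_ge0 : (wedge w P i k).@[p] != 0.
  rewrite /wedge -!mpolyC_nat !mul_mpolyC mevalB !mevalM !mevalZ !mevalXU subr_eq0.
  by rewrite mulrC [X in _ != X]mulrC.
move=> /(_ a f d w_gt0 fh smooth Ph tangent cp).
by rewrite /excess subr_ge0.
Qed.
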